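(* For every integer $n\geq 14$, the $3$-uniform hypergraph $G_n$ described below is $C_3^{(3)}$-saturated. Consequently, $\mathrm{sat}_3(n,C_3^{(3)})\leq \frac{3}{2}n+O(1)$. Construction of $G_n$: write $n=4m+c$ with integers $m$ and $2\leq c\leq 5$. There are two common vertices $x,y$. For each $1\leq i\leq m+2-c$ let $A_i$ be the $3$-uniform hypergraph with vertex set $\{x,y,a_{x,i},a_{y,i},a_{1,i},a_{2,i}\}$ and edges $\{x,a_{x,i},a_{y,i}\}$, $\{y,a_{x,i},a_{y,i}\}$, $\{x,a_{x,i},a_{1,i}\}$, $\{x,a_{x,i},a_{2,i}\}$, $\{y,a_{y,i},a_{1,i}\}$, $\{y,a_{y,i},a_{2,i}\}$. For each $1\leq i\leq c-2$ let $B_i$ be the $3$-uniform hypergraph with vertex set $\{x,y,b_{x,i},b_{y,i},b_{1,i},b_{2,i},b_{3,i}\}$ and edges $\{x,b_{x,i},b_{y,i}\}$, $\{y,b_{x,i},b_{y,i}\}$, $\{b_{1,i},b_{2,i},b_{3,i}\}$, and $\{x,b_{x,i},b_{j,i}\}$, $\{y,b_{y,i},b_{j,i}\}$ for $j=1,2,3$. All the vertices other than $x,y$ are distinct across different $A_i$'s and $B_i$'s, and $G_n$ is the union of all the $A_i$ and $B_i$ (so $G_n$ has exactly $n$ vertices).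
   Context: The $3$-uniform loose cycle $C_3^{(3)}$ is the $3$-uniform hypergraph on $6$ vertices $v_1,\dots,v_6$ with edges $\{v_1,v_2,v_3\}$, $\{v_3,v_4,v_5\}$, $\{v_5,v_6,v_1\}$. A $3$-uniform hypergraph $H$ is $C_3^{(3)}$-saturated if it contains no copy of $C_3^{(3)}$ but $H+e$ contains one for every $3$-set $e\notin E(H)$ of vertices of $H$. $\mathrm{sat}_3(n,C_3^{(3)})$ is the minimum number of edges of a $C_3^{(3)}$-saturated $3$-uniform hypergraph on $n$ vertices. *)

(* Defs.v *)
From mathcomp Require Import all_boot all_order all_algebra.

Set Implicit Arguments.
Unset Strict Implicit.
Unset Printing Implicit Defensive.

(* A hypergraph on the vertex set T is given by its edge set E : {set {set T}}. *)

Definition uniform (r : nat) (T : finType) (E : {set {set T}}) : bool :=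
  [forall e in E, #|e| == r].

(* Copies are not required to be induced. *)
Definition contains_copy (U T : finType) (F : {set {set U}})
    (E : {set {set T}}) : bool :=
  [exists f : {ffun U -> T},
     injectiveb f && [forall e in F, (f @: e) \in E]].

Definition saturated (r : nat) (U T : finType) (F : {set {set U}})
    (E : {set {set T}}) : bool :=
  [&& uniform r E, ~~ contains_copy F E &
      [forall e : {set T},
         (#|e| == r) && (e \notin E) ==> contains_copy F (e |: E)]].

Definition loose_cycle3 : {set {set 'I_6}} :=
  let v (k : nat) : 'I_6 := inord k.-1 in
  [set [set v 1; v 2; v 3]; [set v 3; v 4; v 5]; [set v 5; v 6; v 1]].

Lemma ex_saturated_card (n : nat) :
  exists k, [exists E : {set {set 'I_n}},
               saturated 3 loose_cycle3 E && (#|E| == k)].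
Proof.
pose P (E : {set {set 'I_n}}) :=
  uniform 3 E && ~~ contains_copy loose_cycle3 E.
have P0 : P set0.
  apply/andP; split; first by apply/forall_inP => e; rewrite inE.
  apply/existsP => -[f /andP [_ /forall_inP h]].
  set e0 := [set (inord 0 : 'I_6); inord 1; inord 2].
  have e0F : e0 \in loose_cycle3 by rewrite !inE eqxx.
  by have := h _ e0F; rewrite inE.
have [E /maxsetP [/andP [uE fE] maxE] _] := maxset_exists P0.
exists #|E|; apply/existsP; exists E; rewrite eqxx andbT.
apply/and3P; split=> //; apply/forallP => e; apply/implyP => /andP [e3 eE].
apply: contraR eE => nc.
rewrite -[in X in _ \in X](maxE (e |: E)) ?setU11 ?subsetU1 //.
apply/andP; split=> //; apply/forall_inP => e' /setU1P [-> //|].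
by move/forall_inP: uE; apply.
Qed.

Definition sat3 (n : nat) : nat := ex_minn (ex_saturated_card n).

(* The unique m and c with n = 4 * m + c and 2 <= c <= 5 (for n >= 2). *)
Definition G_c (n : nat) : nat := (n - 2) %% 4 + 2.
Definition G_m (n : nat) : nat := (n - 2) %/ 4.

Lemma G_mcP (n m c : nat) : 1 < n ->
  (n = 4 * m + c /\ 2 <= c <= 5) <-> (m = G_m n /\ c = G_c n).
Proof.
move=> n2; rewrite /G_m /G_c; split=> [[-> /andP [c2 c5]] | [-> ->]].
  have lt4 : c - 2 < 4 by rewrite ltn_subLR.
  rewrite -addnBA // mulnC divnMDl // modnMDl divn_small // modn_small //.
  by rewrite addn0 subnK.
split; first by rewrite addnA mulnC -divn_eq subnK.
by rewrite leq_addl /= -[5]/(3 + 2) leq_add2r -ltnS ltn_pmod.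
Qed.

Definition nA (n : nat) : nat := G_m n + 2 - G_c n.
Definition nB (n : nat) : nat := G_c n - 2.

(* The vertices are x and y (the summand bool), four private vertices a_x, a_y,
   a_1, a_2 for each A_i, and five private vertices b_x, b_y, b_1, b_2, b_3 for
   each B_i; the indices i and j start from 0. *)
Definition GV (n : nat) : finType :=
  (bool + ('I_(nA n) * (bool + 'I_2) + 'I_(nB n) * (bool + 'I_3)))%type.

Section Construction.
Variable n : nat.

Definition vx : GV n := inl true.
Definition vy : GV n := inl false.
Definition ax (i : 'I_(nA n)) : GV n := inr (inl (i, inl true)).
Definition ay (i : 'I_(nA n)) : GV n := inr (inl (i, inl false)).
Definition aj (i : 'I_(nA n)) (j : 'I_2) : GV n := inr (inl (i, inr j)).
Definition bx (i : 'I_(nB n)) : GV n := inr (inr (i, inl true)).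
Definition by_ (i : 'I_(nB n)) : GV n := inr (inr (i, inl false)).
Definition bj (i : 'I_(nB n)) (j : 'I_3) : GV n := inr (inr (i, inr j)).

Definition A_edges (i : 'I_(nA n)) : {set {set GV n}} :=
  [set [set vx; ax i; ay i]; [set vy; ax i; ay i]]
  :|: [set [set vx; ax i; aj i j] | j : 'I_2]
  :|: [set [set vy; ay i; aj i j] | j : 'I_2].

Definition B_edges (i : 'I_(nB n)) : {set {set GV n}} :=
  [set [set vx; bx i; by_ i]; [set vy; bx i; by_ i]; [set bj i j | j : 'I_3]]
  :|: [set [set vx; bx i; bj i j] | j : 'I_3]
  :|: [set [set vy; by_ i; bj i j] | j : 'I_3].

Definition G_edges : {set {set GV n}} :=
  (\bigcup_(i < nA n) A_edges i) :|: (\bigcup_(i < nB n) B_edges i).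

End Construction.

(* Main.v *)
Require Import Defs.
From mathcomp Require Import all_boot all_order all_algebra.
From mathcomp Require Import zify.

Set Implicit Arguments.
Unset Strict Implicit.
Unset Printing Implicit Defensive.

Import GRing.Theory Num.Theory.

(** Every edge of G_n lies in a single block A_i or B_i, and every vertex in at
    least one.  So a copy of the loose triangle meets at most three blocks, and a
    3-set of vertices is covered by three blocks; for n >= 14 there are at least
    three blocks.  Both freeness and saturation therefore reduce to the union of
    three distinct blocks, a hypergraph on at most 17 vertices which up to
    isomorphism depends only on the kinds of the blocks, and there they are
    decided by exhaustive computation.  The bound on sat_3 follows from
    |G_n| <= 6 (m + 2 - c) + 9 (c - 2) = 6 m + 3 c - 6. *)

(** * Ordered triples, 3-sets and loose triangles *)

Section Triples.
Variable T : eqType.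

(** Edges are coded in all six orders, so that asking whether an ordered triple spans an edge
    becomes membership in a list. *)
Definition perms3 (t : T * T * T) : seq (T * T * T) :=
  let: (a, b, c) := t in
  [:: (a, b, c); (a, c, b); (b, a, c); (b, c, a); (c, a, b); (c, b, a)].

Definition triple_map (U : Type) (f : U -> T) (t : U * U * U) : T * T * T :=
  (f t.1.1, f t.1.2, f t.2).

End Triples.

Lemma perms3_map (T U : eqType) (f : U -> T) (t p : U * U * U) :
  p \in perms3 t -> triple_map f p \in perms3 (triple_map f t).
Proof.
case: t => -[a b] c; rewrite /= !inE.
do 5?[case/orP => [/eqP-> | ]; first by rewrite /triple_map /= ?inE ?eqxx ?orbT].
by move/eqP->; rewrite /triple_map /= ?inE ?eqxx ?orbT.
Qed.

Section SetOfTriple.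
Variable T : finType.

Definition triple_set (t : T * T * T) : {set T} := [set t.1.1; t.1.2; t.2].

Lemma triple_set_perms (t p : T * T * T) :
  p \in perms3 t -> triple_set p = triple_set t.
Proof.
case: t => -[a b] c; rewrite /= !inE => tp.
apply/setP => z; rewrite !inE.
have [-> | [-> | [-> | [-> | [-> | ->]]]]] :
    p = (a, b, c) \/ p = (a, c, b) \/ p = (b, a, c) \/ p = (b, c, a)
    \/ p = (c, a, b) \/ p = (c, b, a).
  by do 5?[case/orP: tp => [/eqP-> | tp]; first by tauto]; move/eqP: tp; tauto.
all: by rewrite /=; case: (z == a); case: (z == b); case: (z == c).
Qed.

Lemma perms_triple_set (u v w : T) (t : T * T * T) :
  uniq [:: u; v; w] -> [set u; v; w] = triple_set t -> (u, v, w) \in perms3 t.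
Proof.
case: t => -[a b] c; rewrite /triple_set /= => un eq3.
have: u \in [set a; b; c] by rewrite -eq3 !inE eqxx.
have: v \in [set a; b; c] by rewrite -eq3 !inE eqxx ?orbT.
have: w \in [set a; b; c] by rewrite -eq3 !inE eqxx ?orbT.
rewrite !inE -!orbA => /or3P h1 /or3P h2 /or3P h3.
case: h1 => /eqP ?; case: h2 => /eqP ?; case: h3 => /eqP ?; subst;
  by [rewrite /= !inE eqxx ?orbT ?andbF in un | rewrite /= ?inE ?eqxx ?orbT].
Qed.

End SetOfTriple.

Lemma contains_loose_cycle3P (T : finType) (E : {set {set T}}) :
  reflect (exists v1 v2 v3 v4 v5 v6, [/\ uniq [:: v1; v2; v3; v4; v5; v6],
     [set v1; v2; v3] \in E, [set v3; v4; v5] \in E & [set v5; v6; v1] \in E])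
    (contains_copy loose_cycle3 E).
Proof.
have im3 (f : 'I_6 -> T) a b c : f @: [set a; b; c] = [set f a; f b; f c].
  by rewrite !imsetU !imset_set1.
apply: (iffP existsP) => [[f /andP [/injectiveP finj /forall_inP h]] |].
- exists (f (inord 0)), (f (inord 1)), (f (inord 2)).
  exists (f (inord 3)), (f (inord 4)), (f (inord 5)).
  split; try by rewrite -im3 h // !inE eqxx ?orbT.
  rewrite -[X in uniq X]/(map f [:: inord 0; inord 1; inord 2; inord 3; inord 4; inord 5]).
  by rewrite map_inj_uniq // -(map_inj_uniq val_inj) /= !inordK.
- case=> v1 [v2 [v3 [v4 [v5 [v6 [un e1 e2 e3]]]]]].
  exists [ffun i : 'I_6 => nth v1 [:: v1; v2; v3; v4; v5; v6] i].
  apply/andP; split.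
    apply/injectiveP => i j; rewrite !ffunE => /eqP.
    by rewrite nth_uniq // => /eqP /val_inj.
  apply/forall_inP => e; rewrite !inE -orbA.
  by case/or3P => /eqP ->; rewrite im3 !ffunE !inordK.
Qed.

(** The blocks met by a triangle or a 3-set may coincide. Padding them to exactly three distinct
    blocks leaves only eight patterns of kinds to check. *)
Lemma extend_to_three (T : finType) (a b c : T) : 3 <= #|T| ->
  exists s : seq T, [/\ size s = 3, uniq s & {subset [:: a; b; c] <= s}].
Proof.
move=> T3; pose s := undup [:: a; b; c].
have s3 : size s <= 3 by rewrite (leq_trans (size_undup _)).
have us : uniq s by apply: undup_uniq.
pose r := enum [predC s].
have sr : size s + size r = #|T| by rewrite -cardE -(card_uniqP us) cardC.
exists (s ++ take (3 - size s) r); split.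
- by rewrite size_cat size_takel ?subnKC // leq_subLR sr.
- rewrite cat_uniq us take_uniq ?enum_uniq // andbT /=.
  by apply/hasPn => x /mem_take; rewrite mem_enum.
- by move=> x xs; rewrite mem_cat mem_undup xs.
Qed.

(** * Coded unions of three blocks and the exhaustive check *)

(* Inside a block the labels 0, 1 stand for x, y, the labels 2, 3 for a_x, a_y
   (or b_x, b_y), and 4, 5 (4, 5, 6 in a B-block) for the remaining vertices. *)
Definition local_edges (isB : bool) : seq (nat * nat * nat) :=
  [:: (0, 2, 3); (1, 2, 3)]
  ++ [seq (0, 2, l) | l <- iota 4 (isB + 2)]
  ++ [seq (1, 3, l) | l <- iota 4 (isB + 2)]
  ++ (if isB then [:: (4, 5, 6)] else [::]).

(* A vertex of the union of three blocks is coded by a slot and a label; the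
   common vertices x and y are always put in slot 0. *)
Definition code (s l : nat) : nat * nat := (if l < 2 then 0 else s, l).

Definition codes (ks : seq bool) : seq (nat * nat) :=
  [seq code s l | s <- iota 0 3, l <- iota 0 (6 + nth false ks s)].

Definition code_edges (ks : seq bool) : seq ((nat * nat) * (nat * nat) * (nat * nat)) :=
  flatten [seq flatten [seq perms3 (triple_map (code s) t)
                       | t <- local_edges (nth false ks s)] | s <- iota 0 3].

(* Virtual machine reduction is call-by-value: [&&], [==>] and [has] evaluate all
   their arguments, hence the explicit conditionals, filters and [lazy_has]. *)
Fixpoint lazy_has (T : Type) (a : pred T) (s : seq T) : bool :=
  if s is x :: s' then if a x then true else lazy_has a s' else false.

Lemma lazy_hasE (T : Type) (a : pred T) (s : seq T) : lazy_has a s = has a s.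
Proof. by elim: s => //= x s ->; case: (a x). Qed.

(** The ordered edges [p], [q], [r] are chained end to start and closed up, so the list tested by
    [uniq] is v1, ..., v6 of a candidate loose triangle. *)
Definition code_free (ks : seq bool) : bool :=
  let E := code_edges ks in
  all (fun p => all (fun q =>
    all (fun r => ~~ uniq [:: p.1.1; p.1.2; p.2; q.1.2; q.2; r.1.2])
      [seq r <- [seq r <- E | r.1.1 == q.2] | r.2 == p.1.1])
    [seq q <- E | q.1.1 == p.2]) E.

(* The order of the vertices in the added edge is irrelevant: testing only sorted
   triples makes the computation six times shorter. *)
Definition code_key (c : nat * nat) : nat := 7 * c.1 + c.2.

(** By rotating the cycle, the added edge may be taken as {v1, v2, v3}: [p] runs over its orders,
    while [q] and [r] are old edges. Requiring the six codes to lie in [V] makes decoding injective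
    on them. [codes] lists x and y once per slot, hence [undup]. *)
Definition code_saturated (ks : seq bool) : bool :=
  let E := code_edges ks in let V := undup (codes ks) in
  all (fun a => all (fun b => all (fun c =>
    if ~~ (code_key a <= code_key b <= code_key c) then true else
    if ~~ uniq [:: a; b; c] then true else if (a, b, c) \in E then true else
    lazy_has (fun p => lazy_has (fun q => lazy_has (fun r =>
        let s := [:: p.1.1; p.1.2; p.2; q.1.2; q.2; r.1.2] in
        uniq s && all (mem V) s)
      [seq r <- [seq r <- E | r.1.1 == q.2] | r.2 == p.1.1])
      [seq q <- E | q.1.1 == p.2])
      (perms3 (a, b, c))) V) V) V.

Lemma code_freeT (ks : seq bool) : size ks = 3 -> code_free ks.
Proof.
case: ks => [|k0 [|k1 [|k2 [|//]]]] // _.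
by case: k0; case: k1; case: k2; vm_compute.
Qed.

Lemma code_saturatedT (ks : seq bool) : size ks = 3 -> code_saturated ks.
Proof.
case: ks => [|k0 [|k1 [|k2 [|//]]]] // _.
by case: k0; case: k1; case: k2; vm_compute.
Qed.

Lemma local_edges_lt (k : bool) (t : nat * nat * nat) :
  t \in local_edges k -> [&& t.1.1 < 6 + k, t.1.2 < 6 + k & t.2 < 6 + k].
Proof. by apply/allP: t; case: k. Qed.

(** * Blocks of G_n and the labels of their vertices *)

Section Blocks.
Variable n : nat.

Definition block : finType := ('I_(nA n) + 'I_(nB n))%type.
Definition isB (b : block) : bool := if b is inr _ then true else false.

(** Beyond the labels of the block, [inord] returns a junk vertex; hence the side conditions
    [l < 6 + isB b] below. *)
Definition vert (b : block) (l : nat) : GV n :=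
  match l, b with
  | 0, _ => vx n
  | 1, _ => vy n
  | 2, inl i => ax i
  | 2, inr i => bx i
  | 3, inl i => ay i
  | 3, inr i => by_ i
  | j.+4, inl i => aj i (inord j)
  | j.+4, inr i => bj i (inord j)
  end.

Definition label (v : GV n) : nat :=
  match v with
  | inl b => ~~ b
  | inr (inl (_, inl b)) | inr (inr (_, inl b)) => (~~ b).+2
  | inr (inl (_, inr j)) => j.+4
  | inr (inr (_, inr j)) => j.+4
  end.

(* The vertices x and y lie in every block; they get the default block b0. *)
Definition block_of (b0 : block) (v : GV n) : block :=
  match v with
  | inl _ => b0
  | inr (inl (i, _)) => inl i
  | inr (inr (i, _)) => inr i
  end.

Lemma label_vert (b : block) (l : nat) : l < 6 + isB b -> label (vert b l) = l.
Proof. by case: l b => [|[|[|[|l]]]] [i|i] //= ll; rewrite inordK. Qed.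

Lemma block_of_vert (b0 b : block) (l : nat) : 1 < l -> block_of b0 (vert b l) = b.
Proof. by case: l b => [|[|[|[|l]]]] [i|i]. Qed.

Lemma vert_label (b0 : block) (v : GV n) : vert (block_of b0 v) (label v) = v.
Proof.
by case: v => [[]|[[i [[]|j]]|[i [[]|j]]]] //=; rewrite /aj /bj ?inord_val.
Qed.

Lemma label_lt (b0 : block) (v : GV n) : label v < 6 + isB (block_of b0 v).
Proof.
case: v => [[]|[[i [[]|j]]|[i [[]|j]]]] //=; have := ltn_ord j; lia.
Qed.

Lemma vert_lt2 (b b' : block) (l : nat) : l < 2 -> vert b l = vert b' l.
Proof. by case: l => [|[|]]. Qed.

Definition block_edges (b : block) : seq {set GV n} :=
  [seq triple_set (triple_map (vert b) t) | t <- local_edges (isB b)].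

Lemma mem_G_edges (e : {set GV n}) :
  reflect (exists b, e \in block_edges b) (e \in G_edges n).
Proof.
have ord2 (j : 'I_2) : j = inord 0 \/ j = inord 1.
  by case: j => [[|[|//]] h]; [left|right]; apply: val_inj; rewrite /= inordK.
have ord3 (j : 'I_3) : [\/ j = inord 0, j = inord 1 | j = inord 2].
  case: j => [[|[|[|//]]] h]; [constructor 1|constructor 2|constructor 3];
    by apply: val_inj; rewrite /= inordK.
have imI3 (i : 'I_(nB n)) :
    [set bj i j | j : 'I_3] = [set bj i (inord 0); bj i (inord 1); bj i (inord 2)].
  apply/setP => z; rewrite !inE -orbA; apply/imsetP/or3P.
    by case=> j _ ->; case: (ord3 j) => ->; [constructor 1|constructor 2|constructor 3].
  by case=> /eqP ->; [exists (inord 0)|exists (inord 1)|exists (inord 2)].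
have blockI b t : t \in local_edges (isB b) ->
    triple_set (triple_map (vert b) t) \in block_edges b by apply: map_f.
rewrite !inE; apply: (iffP orP).
- case=> /bigcupP [i _]; rewrite !inE ?imI3 -!orbA.
  + move=> h; exists (inl i); case/or4P: h.
    * by move/eqP->; apply: (blockI (inl i) (0, 2, 3)).
    * by move/eqP->; apply: (blockI (inl i) (1, 2, 3)).
    * case/imsetP=> j _ ->; case: (ord2 j) => ->.
        exact: (blockI (inl i) (0, 2, 4)).
      exact: (blockI (inl i) (0, 2, 5)).
    * case/imsetP=> j _ ->; case: (ord2 j) => ->.
        exact: (blockI (inl i) (1, 3, 4)).
      exact: (blockI (inl i) (1, 3, 5)).
  + move=> h; exists (inr i); case/or4P: h => [| | |/orP []].
    * by move/eqP->; apply: (blockI (inr i) (0, 2, 3)).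
    * by move/eqP->; apply: (blockI (inr i) (1, 2, 3)).
    * by move/eqP->; apply: (blockI (inr i) (4, 5, 6)).
    * case/imsetP=> j _ ->; case: (ord3 j) => ->.
      - exact: (blockI (inr i) (0, 2, 4)).
      - exact: (blockI (inr i) (0, 2, 5)).
      - exact: (blockI (inr i) (0, 2, 6)).
    * case/imsetP=> j _ ->; case: (ord3 j) => ->.
      - exact: (blockI (inr i) (1, 3, 4)).
      - exact: (blockI (inr i) (1, 3, 5)).
      - exact: (blockI (inr i) (1, 3, 6)).
- case=> -[i|i] /mapP [t tE ->]; [left|right]; apply/bigcupP; exists i => //.
  + have xE j : [set vx n; ax i; aj i j] \in A_edges i.
      by rewrite !inE (imset_f (fun j => [set vx n; ax i; aj i j])) ?orbT.
    have yE j : [set vy n; ay i; aj i j] \in A_edges i.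
      by rewrite !inE (imset_f (fun j => [set vy n; ay i; aj i j])) ?orbT.
    rewrite !inE in tE; move: tE; do 5?[case/orP => [/eqP->|]]; last move/eqP->;
      try by rewrite /triple_set /= ?xE ?yE // !inE eqxx ?orbT //.
  + have xE j : [set vx n; bx i; bj i j] \in B_edges i.
      by rewrite !inE (imset_f (fun j => [set vx n; bx i; bj i j])) ?orbT.
    have yE j : [set vy n; by_ i; bj i j] \in B_edges i.
      by rewrite !inE (imset_f (fun j => [set vy n; by_ i; bj i j])) ?orbT.
    rewrite !inE in tE; move: tE; do 8?[case/orP => [/eqP->|]]; last move/eqP->;
      try by rewrite /triple_set /= ?xE ?yE // !inE ?imI3 eqxx ?orbT //.
Qed.

End Blocks.

(** * What the computed checks say about codes *)

Lemma code_edges_free (ks : seq bool) (c1 c2 c3 c4 c5 c6 : nat * nat) :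
  size ks = 3 -> (c1, c2, c3) \in code_edges ks ->
  (c3, c4, c5) \in code_edges ks -> (c5, c6, c1) \in code_edges ks ->
  ~~ uniq [:: c1; c2; c3; c4; c5; c6].
Proof.
move/code_freeT; rewrite /code_free; move: (code_edges ks) => E /allP freeE e1 e2 e3.
have /allP := freeE _ e1 => /(_ (c3, c4, c5)).
rewrite mem_filter eqxx e2 => /(_ isT) /allP /(_ (c5, c6, c1)).
by rewrite !mem_filter !eqxx e3; apply.
Qed.

Lemma code_edges_saturated (ks : seq bool) (a b c : nat * nat) :
  size ks = 3 -> a \in codes ks -> b \in codes ks -> c \in codes ks ->
  code_key a <= code_key b <= code_key c -> uniq [:: a; b; c] ->
  (a, b, c) \notin code_edges ks ->
  exists c1 c2 c3 c4 c5 c6,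
    [/\ (c1, c2, c3) \in perms3 (a, b, c), (c3, c4, c5) \in code_edges ks,
        (c5, c6, c1) \in code_edges ks, uniq [:: c1; c2; c3; c4; c5; c6] &
        {subset [:: c1; c2; c3; c4; c5; c6] <= codes ks}].
Proof.
move/code_saturatedT; rewrite /code_saturated.
move: (code_edges ks) (codes ks) => E V /allP satE aV bV cV srt abcU abcE.
have := satE a; rewrite mem_undup => /(_ aV) /allP /(_ b).
rewrite mem_undup => /(_ bV) /allP /(_ c).
rewrite mem_undup srt abcU (negPf abcE) lazy_hasE => /(_ cV) /hasP [[[c1 c2] c3] pE].
rewrite lazy_hasE => /hasP [[[c3' c4] c5]].
rewrite mem_filter => /andP [/eqP q1 qE].
rewrite lazy_hasE => /hasP [[[c5' c6] c1']].
rewrite !mem_filter => /and3P [/eqP r1 /eqP r2 rE] /andP [cU /allP csV].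
rewrite /= in q1 r1 r2; subst c3' c5' c1'.
exists c1, c2, c3, c4, c5, c6; split=> // z /csV.
by rewrite /= mem_undup.
Qed.

(** With [k] the key of the code, this brings a 3-set into the sorted form covered by
    [code_saturated]. *)
Lemma sorted_triple (T : finType) (k : T -> nat) (e : {set T}) : #|e| = 3 ->
  exists u v w, [/\ e = [set u; v; w], uniq [:: u; v; w] & k u <= k v <= k w].
Proof.
pose le u v := k u <= k v; pose s := sort le (enum e) => e3.
have ss : sorted le s by apply: sort_sorted => u v; apply: leq_total.
have us : uniq s by rewrite sort_uniq enum_uniq.
have mem_s z : (z \in s) = (z \in e) by rewrite mem_sort mem_enum.
have: size s = 3 by rewrite size_sort -cardE.
case: s ss us mem_s => [|u [|v [|w []]]] //= /and3P [uv vw _] us mem_s _.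
exists u, v, w; split=> //; last exact/andP.
by apply/setP => z; rewrite -mem_s !inE orbA.
Qed.

(** * Transfer between three blocks of G_n and codes *)

Section ThreeBlocks.
Variables (n : nat) (b0 : block n) (bs : seq (block n)).
Hypotheses (bs3 : size bs = 3) (bsU : uniq bs).

Let ks := map (@isB n) bs.

Definition enc (v : GV n) : nat * nat := code (index (block_of b0 v) bs) (label v).
Definition dec (c : nat * nat) : GV n := vert (nth b0 bs c.1) c.2.

Lemma nth_ks (s : nat) : s < 3 -> nth false ks s = isB (nth b0 bs s).
Proof. by move=> s3; rewrite (nth_map b0) ?bs3. Qed.

Lemma enc_vert (b : block n) (l : nat) :
  l < 6 + isB b -> enc (vert b l) = code (index b bs) l.
Proof.
move=> lb; rewrite /enc label_vert // /code.
by case: ltnP => // l2; rewrite block_of_vert.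
Qed.

Lemma dec_code (s l : nat) : dec (code s l) = vert (nth b0 bs s) l.
Proof. by rewrite /dec /=; case: ifP => // l2; apply: vert_lt2. Qed.

Lemma enc_dec (c : nat * nat) : c \in codes ks -> enc (dec c) = c.
Proof.
case/allpairsPdep=> s [l [+ + ->]]; rewrite !mem_iota /= !add0n => s3.
rewrite nth_ks // => lb.
by rewrite dec_code enc_vert // index_uniq ?bs3.
Qed.

(** This covers x and y even when the default block [b0] is outside [bs]: they are common to all
    blocks, so decoding them in any slot gives them back. *)
Lemma dec_enc_vert (b : block n) (l : nat) :
  b \in bs -> l < 6 + isB b -> dec (enc (vert b l)) = vert b l.
Proof. by move=> bbs lb; rewrite enc_vert // dec_code nth_index. Qed.

Lemma dec_enc (v : GV n) : block_of b0 v \in bs -> dec (enc v) = v.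
Proof. by move=> vbs; rewrite -(vert_label b0 v) dec_enc_vert ?label_lt. Qed.

Lemma enc_codes (v : GV n) : block_of b0 v \in bs -> enc v \in codes ks.
Proof.
move=> vbs; have i3 : index (block_of b0 v) bs < 3 by rewrite -bs3 index_mem.
apply/allpairsPdep; exists (index (block_of b0 v) bs), (label v).
by rewrite !mem_iota /= !add0n i3 nth_ks // nth_index // label_lt.
Qed.

Lemma mem_code_edges (p : (nat * nat) * (nat * nat) * (nat * nat)) :
  reflect (exists s t, [/\ s < 3, t \in local_edges (nth false ks s)
                         & p \in perms3 (triple_map (code s) t)])
    (p \in code_edges ks).
Proof.
apply: (iffP flatten_mapP) => [[s +] /flatten_mapP [t tE pE] | [s [t [s3 tE pE]]]].
  by rewrite mem_iota => s3; exists s, t.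
by exists s; rewrite ?mem_iota //; apply/flatten_mapP; exists t.
Qed.

Lemma dec_edge (p : (nat * nat) * (nat * nat) * (nat * nat)) :
  p \in code_edges ks -> triple_set (triple_map dec p) \in G_edges n.
Proof.
case/mem_code_edges=> s [t [s3 tE /(perms3_map dec) /triple_set_perms ->]].
apply/mem_G_edges; exists (nth b0 bs s); apply/mapP; exists t.
  by rewrite -nth_ks.
by rewrite /triple_map /= !dec_code.
Qed.

Lemma enc_edge (b : block n) (u v w : GV n) :
  b \in bs -> uniq [:: u; v; w] -> [set u; v; w] \in block_edges b ->
  (enc u, enc v, enc w) \in code_edges ks.
Proof.
move=> bbs uE /mapP [t tE eqt].
have i3 : index b bs < 3 by rewrite -bs3 index_mem.
apply/mem_code_edges; exists (index b bs), t.
rewrite nth_ks // nth_index //; split=> //.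
have := perms3_map enc (perms_triple_set uE eqt).
have /and3P [l1 l2 l3] := local_edges_lt tE.
by rewrite /triple_map /= !enc_vert.
Qed.

Lemma dec_enc_edge (b : block n) (e : {set GV n}) (v : GV n) :
  b \in bs -> e \in block_edges b -> v \in e -> dec (enc v) = v.
Proof.
move=> bbs /mapP [t tE ->]; have /and3P [l1 l2 l3] := local_edges_lt tE.
rewrite !inE -orbA => /or3P [] /eqP ->; exact: dec_enc_vert.
Qed.

(** Encoding is injective on the vertices of edges of these blocks, so a loose triangle would yield
    a coded one, which the computation excludes. *)
Lemma three_blocks_free (b1 b2 b3 : block n) (v1 v2 v3 v4 v5 v6 : GV n) :
  {subset [:: b1; b2; b3] <= bs} -> uniq [:: v1; v2; v3; v4; v5; v6] ->
  [set v1; v2; v3] \in block_edges b1 -> [set v3; v4; v5] \in block_edges b2 ->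
  [set v5; v6; v1] \in block_edges b3 -> False.
Proof.
move=> sub U e1 e2 e3.
have [i1 i2 i3] : [/\ b1 \in bs, b2 \in bs & b3 \in bs].
  by split; apply: sub; rewrite !inE eqxx ?orbT.
have U1 : uniq [:: v1; v2; v3] := mask_uniq U [:: true; true; true].
have U2 : uniq [:: v3; v4; v5] :=
  mask_uniq U [:: false; false; true; true; true].
have U3 : uniq [:: v5; v6; v1].
  (* The third edge wraps around: v5, v6, v1 is a rotation of the subsequence v1, v5, v6. *)
  rewrite -(rotr_uniq 1).
  exact: (mask_uniq U [:: true; false; false; false; true; true]).
have encU : uniq (map enc [:: v1; v2; v3; v4; v5; v6]).
  rewrite map_inj_in_uniq // => u v uv vv.
  have K z : z \in [:: v1; v2; v3; v4; v5; v6] -> dec (enc z) = z.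
    rewrite !inE => /or4P [/eqP->|/eqP->|/eqP->|/or3P [/eqP->|/eqP->|/eqP->]].
    1,2,3: by apply: (dec_enc_edge i1 e1); rewrite !inE eqxx ?orbT.
    1,2: by apply: (dec_enc_edge i2 e2); rewrite !inE eqxx ?orbT.
    by apply: (dec_enc_edge i3 e3); rewrite !inE eqxx ?orbT.
  by move=> euv; rewrite -(K u) // -(K v) // euv.
have ks3 : size ks = 3 by rewrite size_map.
apply/negP: encU; apply: (code_edges_free ks3).
- exact: (enc_edge i1 U1 e1).
- exact: (enc_edge i2 U2 e2).
- exact: (enc_edge i3 U3 e3).
Qed.

(** The code of [e] is a non-edge, so the computation closes a coded triangle through it; decoding
    is injective on [codes ks] and sends coded edges to edges of G_n. *)
Lemma three_blocks_saturated (e : {set GV n}) :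
  {in e, forall v, block_of b0 v \in bs} -> #|e| = 3 -> e \notin G_edges n ->
  contains_copy loose_cycle3 (e |: G_edges n).
Proof.
move=> ebs /(sorted_triple (code_key \o enc)) [u [v [w [eE U /= srt]]]] eG.
have [ub vb wb] : [/\ block_of b0 u \in bs, block_of b0 v \in bs
                    & block_of b0 w \in bs].
  by split; apply: ebs; rewrite eE !inE eqxx ?orbT.
have ks3 : size ks = 3 by rewrite size_map.
have eU : uniq [:: enc u; enc v; enc w].
  have K z : z \in [:: u; v; w] -> dec (enc z) = z.
    by rewrite !inE => /or3P [] /eqP ->; apply: dec_enc.
  rewrite -[X in uniq X]/(map enc [:: u; v; w]) map_inj_in_uniq // => x y xs ys exy.
  by rewrite -(K x) // -(K y) // exy.
have encE : (enc u, enc v, enc w) \notin code_edges ks.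
  apply: contra eG => /dec_edge.
  by rewrite /triple_map /= !dec_enc // /triple_set /= -eE.
have [c1 [c2 [c3 [c4 [c5 [c6 [pE qE rE cU csV]]]]]]] :=
  code_edges_saturated ks3 (enc_codes ub) (enc_codes vb) (enc_codes wb) srt eU encE.
apply/contains_loose_cycle3P.
exists (dec c1), (dec c2), (dec c3), (dec c4), (dec c5), (dec c6); split.
- rewrite -[X in uniq X]/(map dec [:: c1; c2; c3; c4; c5; c6]) map_inj_in_uniq // => x y /csV + /csV.
  by move=> /enc_dec {2}<- /enc_dec {2}<- ->.
- have /(perms3_map dec)/triple_set_perms := pE.
  by rewrite /triple_map /= !dec_enc // /triple_set /= -eE => ->; rewrite setU11.
- by apply: setU1r; apply: (dec_edge qE).
- by apply: setU1r; apply: (dec_edge rE).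
Qed.

End ThreeBlocks.

(** * Saturation of G_n *)

(** From n = 14 on, m >= 3, so c <= 5 <= m + 2: the subtraction in [nA] does not truncate and there
    are exactly m blocks. *)
Lemma block_card_gt2 (n : nat) : 14 <= n -> 3 <= #|block n|.
Proof.
move=> n14; rewrite card_sum !card_ord /nA /nB /G_c /G_m; lia.
Qed.

Lemma saturated_G (n : nat) : 14 <= n -> saturated 3 loose_cycle3 (G_edges n).
Proof.
move=> /block_card_gt2 B3.
have /card_gt0P [b0 _] : 0 < #|block n| by apply: leq_trans B3.
apply/and3P; split.
- apply/forall_inP => e /mem_G_edges [b /mapP [t tE ->]].
  have tU : uniq [:: t.1.1; t.1.2; t.2].
    by move: tE; apply/allP: t; case: (isB b).
  have /and3P [l1 l2 l3] := local_edges_lt tE.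
  have vU : uniq (map (vert b) [:: t.1.1; t.1.2; t.2]).
    rewrite map_inj_in_uniq // => x y xs ys.
    have lt z : z \in [:: t.1.1; t.1.2; t.2] -> z < 6 + isB b.
      by rewrite !inE => /or3P [] /eqP ->.
    by move/(congr1 (@label n)); rewrite !label_vert ?lt.
  have -> : triple_set (triple_map (vert b) t) =
      [set z in map (vert b) [:: t.1.1; t.1.2; t.2]].
    by apply/setP => z; rewrite !inE orbA.
  by rewrite cardsE (card_uniqP vU).
- apply/contains_loose_cycle3P => -[v1 [v2 [v3 [v4 [v5 [v6 [U]]]]]]].
  move=> /mem_G_edges [b1 e1] /mem_G_edges [b2 e2] /mem_G_edges [b3 e3].
  have [bs [bs3 _ sub]] := extend_to_three b1 b2 b3 B3.
  exact: (three_blocks_free b0 bs3 sub U e1 e2 e3).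
- apply/forallP => e; apply/implyP => /andP [/eqP e3 eG].
  (* The order is irrelevant here, so the key is constant; the elements are named only to find
     blocks that cover [e]. *)
  have [u [v [w [eE _ _]]]] := sorted_triple (fun=> 0) e3.
  have [bs [bs3 bsU sub]] :=
    extend_to_three (block_of b0 u) (block_of b0 v) (block_of b0 w) B3.
  apply: (three_blocks_saturated bs3 bsU (b0 := b0)) => // z.
  rewrite eE !inE -orbA => /or3P [] /eqP ->; apply: sub;
    by rewrite !inE eqxx ?orbT.
Qed.

(** * Numbers of vertices and edges *)

(** The count is 2 + 4 (m + 2 - c) + 5 (c - 2) = 4 m + c. *)
Lemma card_GV (n : nat) : 14 <= n -> #|GV n| = n.
Proof.
move=> n14; rewrite !(card_sum, card_prod, card_ord, card_bool).
rewrite /nA /nB /G_c /G_m; lia.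
Qed.

Lemma card_G_edges (n : nat) : #|G_edges n| <= 6 * nA n + 9 * nB n.
Proof.
have bigU m (F : 'I_m -> {set {set GV n}}) k :
    (forall i, #|F i| <= k) -> #|\bigcup_(i < m) F i| <= k * m.
  move=> Fk; have -> : k * m = \sum_(i < m) k by rewrite sum_nat_const card_ord mulnC.
  elim/big_rec2: _ => [|i s A _ IH]; first by rewrite cards0.
  by rewrite (leq_trans (leq_card_setU _ _)) // leq_add.
have U2 (T : finType) (A B : {set T}) a b :
    #|A| <= a -> #|B| <= b -> #|A :|: B| <= a + b.
  by move=> Aa Bb; rewrite (leq_trans (leq_card_setU _ _)) // leq_add.
have im (T U : finType) (f : T -> U) k : #|T| = k -> #|[set f j | j : T]| <= k.
  by move=> <-; apply: leq_imset_card.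
apply: (U2 _ _ _); apply: (bigU _ _) => i.
- apply: (U2 _ _ _ 4 2); last by apply: (im _ _); rewrite card_ord.
  apply: (U2 _ _ _ 2 2); last by apply: (im _ _); rewrite card_ord.
  by apply: (U2 _ _ _ 1 1); rewrite cards1.
- apply: (U2 _ _ _ 6 3); last by apply: (im _ _); rewrite card_ord.
  apply: (U2 _ _ _ 3 3); last by apply: (im _ _); rewrite card_ord.
  apply: (U2 _ _ _ 2 1); last by rewrite cards1.
  by apply: (U2 _ _ _ 1 1); rewrite cards1.
Qed.

(** * Renaming vertices and the bound on sat_3 *)

Definition relabel (T U : finType) (f : T -> U) (E : {set {set T}}) :
    {set {set U}} :=
  [set f @: e | e : {set T} in E].

Lemma contains_copy_relabel (W T U : finType) (F : {set {set W}}) (f : T -> U)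
    (E : {set {set T}}) :
  injective f -> contains_copy F E -> contains_copy F (relabel f E).
Proof.
move=> finj /existsP [g /andP [/injectiveP ginj /forall_inP gE]].
apply/existsP; exists [ffun z => f (g z)]; apply/andP; split.
  by apply/injectiveP => x y; rewrite !ffunE => /finj /ginj.
apply/forall_inP => e eF; have -> : [ffun z => f (g z)] @: e = f @: (g @: e).
  by rewrite -imset_comp; apply: eq_imset => z; rewrite ffunE.
by apply: imset_f; apply: gE.
Qed.

Lemma relabelK (T U : finType) (f : T -> U) (g : U -> T) :
  cancel f g -> cancel (relabel f) (relabel g).
Proof.
move=> fK E; rewrite /relabel -imset_comp -[RHS]imset_id.
apply: eq_imset => e /=; rewrite -imset_comp -[RHS]imset_id.
exact: eq_imset.
Qed.

Lemma relabelU1 (T U : finType) (f : T -> U) (e : {set T}) (E : {set {set T}}) :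
  relabel f (e |: E) = f @: e |: relabel f E.
Proof. by rewrite /relabel imsetU imset_set1. Qed.

Lemma saturated_relabel (r : nat) (W T U : finType) (F : {set {set W}})
    (f : T -> U) (E : {set {set T}}) :
  bijective f -> saturated r F E -> saturated r F (relabel f E).
Proof.
case=> g fK gK /and3P [/forall_inP uE fE /forallP sE].
have finj := can_inj fK; have ginj := can_inj gK.
apply/and3P; split.
- by apply/forall_inP => _ /imsetP [e eE ->]; rewrite card_imset // uE.
- apply: contra fE => /(contains_copy_relabel ginj).
  by rewrite (relabelK fK).
- apply/forallP => e; apply/implyP => /andP [e3 eE].
  have feK : f @: (g @: e) = e.
    by rewrite -imset_comp -[RHS]imset_id; apply: eq_imset.
  have /implyP := sE (g @: e); rewrite card_imset // e3 /=.
  have -> : g @: e \notin E.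
    by apply: contra eE => geE; rewrite -feK imset_f.
  by move=> /(_ isT) /(contains_copy_relabel finj); rewrite relabelU1 feK.
Qed.

(** [sat3] minimises over hypergraphs on ['I_n] while G_n lives on [GV n]; the enumeration bijection
    carries one to the other. *)
Lemma sat3_le (T : finType) (E : {set {set T}}) :
  saturated 3 loose_cycle3 E -> sat3 #|T| <= #|E|.
Proof.
move=> satE; have sat' := saturated_relabel (@enum_rank_bij T) satE.
have: #|relabel (@enum_rank T) E| <= #|E| by apply: leq_imset_card.
apply: leq_trans.
rewrite /sat3; case: ex_minnP => k _; apply.
by apply/existsP; exists (relabel (@enum_rank T) E); rewrite sat' eqxx.
Qed.

Theorem theorem2p2 :
  (forall n : nat, 14 <= n ->
     #|GV n| = n /\ saturated 3 loose_cycle3 (G_edges n))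
  /\ (exists C : rat, forall n : nat, 14 <= n ->
        ((sat3 n)%:R <= 3%:R / 2%:R * n%:R + C :> rat)%R).
Proof.
split=> [n n14|]; first by split; [apply: card_GV | apply: saturated_G].
(* Twice the edge bound 6 m + 3 c - 6 is 3 n + 3 c - 12 <= 3 n + 3, since c <= 5; so 3/2 would do
   for the constant, and 2 is the next integer. *)
exists (2%:R)%R => n n14.
have le_sat : 2 * sat3 n <= 3 * n + 4.
  have := sat3_le (saturated_G n14); rewrite card_GV //.
  have := card_G_edges n; rewrite /nA /nB /G_c /G_m; lia.
rewrite -(@ler_pM2l _ (2%:R)%R) // mulrDr mulrA mulrCA mulfV // mulr1.
by rewrite -!natrM -natrD ler_nat.
Qed.
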